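(* Let $\ell_1,\ell_2\in\mathbb{N}\setminus\{1\}$ satisfy $\gcd(\ell_1,\ell_2)=1$, and let $p(x,y):=x^{\ell_1}y^{\ell_2}-1$. Suppose that $n\ge\ell_1+\ell_2$. Then every polynomial $f\in\mathcal{P}_{2n}$ that is strictly positive on $\mathcal{Z}_p$ admits a representation $$f=\sum_{j=1}^r g_j^2+ph,$$ where $g_1,\ldots,g_r,h\in\mathbb{R}[x,y]$ and $g_j^2,\ ph\in\mathcal{P}_{2(n+\ell_1+\ell_2-1)}$ for $j=1,\ldots,r$.
   Context: Here $\mathbb{N}=\{1,2,\ldots\}$, $\mathcal{P}_m=\{f\in\mathbb{R}[x,y]:\deg f\le m\}$, and $\mathcal{Z}_p=\{(x,y)\in\mathbb{R}^2:p(x,y)=0\}$. *)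

(* Defs.v *)
From HB Require Import structures.
From mathcomp Require Import all_boot all_order all_algebra.
From mathcomp Require Import reals.
From mathcomp Require Import mpoly.

Set Implicit Arguments.
Unset Strict Implicit.
Unset Printing Implicit Defensive.

Import Order.TTheory GRing.Theory Num.Theory.
Local Open Scope ring_scope.

Section BivariatePolynomials.
Variable R : realType.

Definition X : {mpoly R[2]} := 'X_(0 : 'I_2).
Definition Y : {mpoly R[2]} := 'X_(1 : 'I_2).

(* [msize f] is the total degree plus one, and [msize 0 = 0], so the zero
   polynomial has degree at most m for every m. *)
Definition deg_le (m : nat) (f : {mpoly R[2]}) : bool := (msize f <= m.+1)%N.

(* A point (x, y) of the plane is the valuation v with v 0 = x and v 1 = y. *)
Definition zero_locus (q : {mpoly R[2]}) (v : 'I_2 -> R) : Prop := q.@[v] = 0.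

Definition monomial_curve (l1 l2 : nat) : {mpoly R[2]} := X ^+ l1 * Y ^+ l2 - 1.

End BivariatePolynomials.

(* Main.v *)
Require Import Defs.
From mathcomp Require Import all_boot all_order all_algebra.
From mathcomp Require Import reals.
From mathcomp Require Import mpoly.
From mathcomp Require Import polyrcf complex.
From mathcomp Require Import zify ring lra.

Set Implicit Arguments.
Unset Strict Implicit.
Unset Printing Implicit Defensive.

Import Order.TTheory GRing.Theory Num.Theory.
Local Open Scope ring_scope.

(** On the curve of equation x ^ l1 * y ^ l2 = 1 the real points are exactly
    (t ^ l2, t ^ - l1) with t nonzero, and since l1 and l2 are coprime the
    coordinate ring is the whole ring of Laurent polynomials in t. A polynomial
    f of degree at most 2n thus becomes t ^ - (2 n l1) * P(t) with P a
    polynomial of degree at most 2 n (l1 + l2), and positivity of f on the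
    curve makes P nonnegative on the real line ([pullback_ge0]).

    Hence P is a sum of squares A ^ 2 with deg A <= n (l1 + l2)
    ([poly_ge0_sum_sqr]), and it remains to lift each t ^ - (n l1) * A(t) to a
    bivariate polynomial of low degree. The power t ^ (k - n l1), for
    0 <= k <= n (l1 + l2), is the restriction of every monomial x ^ i y ^ j with
    i l2 - j l1 = k - n l1; reducing j modulo l2 (or i modulo l1 when the power
    is negative) leaves one of degree at most n + l1 + l2 - 2
    ([low_degree_exponents], [low_degree_lift]). The sum of the squares of the
    lifts then agrees with f in the coordinate ring, and the degree of the
    difference, a multiple of the equation of the curve, is bounded by those of
    its terms.

    Laurent polynomials are not introduced as such: two monomials U and V of
    R[x, y] play the roles of t and t ^ -1 modulo the equation of the curve
    ([exists_curve_parameter]), so that V ^ (s l1) * A(U) stands for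
    t ^ - (s l1) * A(t). *)

(** * Nonnegative univariate polynomials are sums of squares *)

Lemma poly_ge0_limit (R : rcfType) (Q : {poly R}) (a : R) :
  (forall t, t != a -> 0 <= Q.[t]) -> 0 <= Q.[a].
Proof.
move=> Q_ge0; rewrite leNgt; apply/negP => Qa_lt0.
have [|d d_gt0 Qd] := @poly_cont _ a Q (- Q.[a]); first by rewrite oppr_gt0.
have := Qd (a + d / 2%:R); rewrite [a + _ - a]addrC addKr gtr0_norm; last by lra.
have := Q_ge0 (a + d / 2%:R).
rewrite -subr_eq0 [a + _ - a]addrC addKr; move: (Q.[a + _]) => q.
move=> q_ge0 /(_ ltac:(lra)); rewrite ltr_norml => /andP[_].
have := q_ge0 ltac:(lra); lra.
Qed.

(** If [Q.[a]] were nonzero, [Q] would keep its sign near [a], while the factor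
    [t - a] changes sign there. *)
Lemma poly_ge0_double_root (R : rcfType) (Q : {poly R}) (a : R) :
  (forall t, 0 <= (('X - a%:P) * Q).[t]) -> Q.[a] = 0.
Proof.
move=> Q_ge0.
have sgnQ t : 0 <= (t - a) * Q.[t] by have := Q_ge0 t; rewrite !hornerE.
apply/eqP; rewrite -[_ == 0]negbK; apply/negP => Qa_neq0.
have [|d d_gt0 Qd] := @poly_cont _ a Q `|Q.[a]|; first by rewrite normr_gt0.
have := Qd (a + d / 2%:R); have := Qd (a - d / 2%:R).
rewrite ![a + _ - a]addrC !addKr normrN gtr0_norm; last by lra.
move=> /(_ ltac:(lra)) Ql /(_ ltac:(lra)) Qr.
have := sgnQ (a + d / 2%:R); have := sgnQ (a - d / 2%:R).
rewrite ![a + _ - a]addrC !addKr mulNr oppr_ge0 pmulr_rle0 ?pmulr_rge0; try lra.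
move: Ql Qr; rewrite !ltr_norml => /andP[Ql1 Ql2] /andP[Qr1 Qr2].
have [Qa|Qa|Qa] := ltrgt0P Q.[a]; last by rewrite Qa eqxx in Qa_neq0.
  by rewrite gtr0_norm // in Ql1 Ql2 Qr1 Qr2; lra.
by rewrite ltr0_norm // in Ql1 Ql2 Qr1 Qr2; lra.
Qed.

(** The numbers [a] and [b] are the real and imaginary parts of a complex root.
    If [b != 0] then the quadratic factor divides [P] because the remainder is a
    real polynomial of degree at most one with a nonreal root; if [b = 0] then
    [a] is a real root, and it is double. *)
Lemma poly_ge0_quadratic_factor (R : rcfType) (P : {poly R}) :
    (1 < size P)%N -> (forall t, 0 <= P.[t]) ->
  exists a b Q, P = (('X - a%:P) ^+ 2 + (b ^+ 2)%:P) * Q.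
Proof.
move=> sP P_ge0.
have /closed_rootP[[a b] rootP] : size (map_poly (real_complex R) P) != 1%N.
  by rewrite size_map_poly gtn_eqF.
exists a, b; have [b0|b_neq0] := eqVneq b 0.
  have /factor_theorem[S PE] : root P a.
    by rewrite -(fmorph_root (real_complex R)) /=; rewrite b0 in rootP.
  have /eqP/factor_theorem[Q SE] : S.[a] = 0.
    by apply: poly_ge0_double_root => t; rewrite mulrC -PE.
  by exists Q; rewrite b0 PE SE expr0n addr0; ring.
set q := (_ + _); have sq : size q = 3%N.
  rewrite /q size_polyDl ?size_exp_XsubC // (leq_ltn_trans (size_polyC_leq1 _)) //.
have rE : P %% q = (P %% q)`_1 *: 'X + ((P %% q)`_0)%:P.
  apply/polyP => i; rewrite !coefE.
  have sr : (size (P %% q)%R <= 2)%N.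
    by rewrite -ltnS -sq ltn_modp -size_poly_eq0 sq.
  case: i => [|[|i]] //=; rewrite ?mulr0 ?mulr1 ?add0r ?addr0 //.
  by rewrite nth_default // (leq_trans sr).
(* [q] vanishes at the root [a + i b], hence so does the remainder. *)
have : (map_poly (real_complex R) (P %% q)).[Complex a b] = 0.
  have := rootP; rewrite {1}(divp_eq P q) rmorphD rmorphM /= rootE hornerD hornerM.
  rewrite (_ : (map_poly _ q).[_] = 0) ?mulr0 ?add0r => [/eqP//|].
  rewrite /q rmorphD rmorphXn /= map_polyXsubC map_polyC /= !hornerE.
  by apply/eqP; rewrite eq_complex /= ; apply/andP; split; apply/eqP; rewrite /=; ring.
rewrite rE rmorphD /= map_polyZ /= map_polyX map_polyC /= !hornerE.
(* The imaginary part of [c1 * (a + i b) + c0] is [c1 * b]. *)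
move: (_`_1) (_`_0) rE => c1 c0 rE /eqP; rewrite eq_complex /=.
rewrite !(mul0r, addr0, subr0) => /andP[/eqP c0E /eqP c1E].
have {}c1E : c1 = 0 by apply/eqP; move/eqP: c1E; rewrite mulf_eq0 (negPf b_neq0) orbF.
have {}c0E : c0 = 0 by move: c0E; rewrite c1E mul0r add0r.
exists (P %/ q); rewrite mulrC [LHS](divp_eq P q) rE c1E c0E.
by rewrite scale0r !addr0.
Qed.

(** Quadratic factors are split off one at a time, and the sum of squares
    obtained for the cofactor is multiplied back by means of the identity
    [A ^+ 2 * (('X - a) ^+ 2 + b ^+ 2) = (A * ('X - a)) ^+ 2 + (A * b) ^+ 2].
    The size bound says that [deg A <= deg P / 2]. *)
Lemma poly_ge0_sum_sqr (R : rcfType) (P : {poly R}) :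
    (forall t, 0 <= P.[t]) ->
  exists s : seq {poly R}, P = \sum_(A <- s) A ^+ 2 /\
    {in s, forall A : {poly R}, 2 * size A <= (size P).+1}%N.
Proof.
have [m] := ubnP (size P); elim: m P => // m IHm P sP P_ge0.
have [sP1|sP1] := leqP (size P) 1%N.
  have PE := size1_polyC sP1; set c := P`_0 in PE.
  have c_ge0 : 0 <= c by have := P_ge0 0; rewrite PE hornerC.
  have [c0|c_neq0] := eqVneq c 0.
    by exists [::]; rewrite big_nil PE c0.
  exists [:: (Num.sqrt c)%:P]; rewrite big_seq1 -rmorphXn sqr_sqrtr //; split=> // A.
  rewrite inE => /eqP ->; rewrite PE size_polyC c_neq0.
  by rewrite (leq_trans (leq_mul (leqnn 2) (size_polyC_leq1 _))).
have [a [b [Q PE]]] := poly_ge0_quadratic_factor sP1 P_ge0.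
have Q_ge0 t : 0 <= Q.[t].
  have off s : s != a -> 0 <= Q.[s].
    move=> sa; have := P_ge0 s; rewrite PE !hornerE pmulr_rge0 //.
    by rewrite ltr_wpDr ?sqr_ge0 // exprn_even_gt0 //= subr_eq0.
  by have [->|/off//] := eqVneq t a; apply: poly_ge0_limit.
set q := (_ + _) in PE; have sq : size q = 3%N.
  by rewrite /q size_polyDl ?size_exp_XsubC // (leq_ltn_trans (size_polyC_leq1 _)).
have Q_neq0 : Q != 0 by apply: contraTneq sP1 => Q0; rewrite PE Q0 mulr0 size_poly0.
have sPE : size P = (size Q).+2.
  by rewrite PE size_mul // -?size_poly_eq0 sq.
have [|s [QE sA]] := IHm Q _ Q_ge0; first by rewrite -ltnS -ltnS -sPE ltnW.
exists (flatten [seq [:: A * ('X - a%:P); A * b%:P] | A <- s]); split.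
  rewrite big_flatten big_map /= PE QE mulr_sumr; apply: eq_bigr => A _.
  by rewrite big_cons big_seq1 /q rmorphXn /=; ring.
move=> B /flatten_mapP[A /sA]; rewrite sPE => As; rewrite !inE => /orP[] /eqP ->.
  have [->|A0] := eqVneq A 0; first by rewrite mul0r size_poly0.
  have bound u w : (2 * u <= w.+1 -> 2 * (u + 2).-1 <= w.+3)%N by lia.
  by rewrite size_Mmonic ?monicXsubC // size_XsubC; apply: bound.
have bound u v w : (v <= u -> 2 * u <= w.+1 -> 2 * v <= w.+3)%N by lia.
by apply: bound As; rewrite mulrC mul_polyC size_scale_leq.
Qed.

(** * Congruence modulo an element of a commutative ring *)

Definition congr_mod (S : comPzRingType) (p x y : S) := exists h, x - y = p * h.

Section CongrMod.
Variables (S : comPzRingType) (p : S).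
Local Notation "x ≡ y" := (congr_mod p x y) (at level 70).

Lemma congr_mod_refl x : x ≡ x.
Proof. by exists 0; rewrite subrr mulr0. Qed.

Lemma congr_mod_sym x y : x ≡ y -> y ≡ x.
Proof. by case=> h xy; exists (- h); rewrite mulrN -xy opprB. Qed.

Lemma congr_mod_trans y x z : x ≡ y -> y ≡ z -> x ≡ z.
Proof. by case=> h xy [k yz]; exists (h + k); rewrite mulrDr -xy -yz; ring. Qed.

Lemma congr_modD x y z t : x ≡ y -> z ≡ t -> x + z ≡ y + t.
Proof. by case=> h xy [k zt]; exists (h + k); rewrite mulrDr -xy -zt; ring. Qed.

Lemma congr_modM x y z t : x ≡ y -> z ≡ t -> x * z ≡ y * t.
Proof.
case=> h xy [k zt]; exists (h * z + y * k).
rewrite mulrDr mulrA -xy mulrCA -zt; ring.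
Qed.

Lemma congr_modX x y k : x ≡ y -> x ^+ k ≡ y ^+ k.
Proof.
move=> xy; elim: k => [|k IHk]; first exact: congr_mod_refl.
by rewrite !exprS; apply: congr_modM.
Qed.

Lemma congr_mod_sum (I : eqType) (r : seq I) (F G : I -> S) :
  {in r, forall i, F i ≡ G i} -> \sum_(i <- r) F i ≡ \sum_(i <- r) G i.
Proof.
elim: r => [|i r IHr] FG; first by rewrite !big_nil; apply: congr_mod_refl.
rewrite !big_cons; apply: congr_modD; first by apply: FG; rewrite mem_head.
by apply: IHr => j jr; apply: FG; rewrite inE jr orbT.
Qed.

End CongrMod.

(** * Monomials in two variables *)

Section TwoVariables.
Variable R : realType.
Local Notation X := (X R).
Local Notation Y := (Y R).

Lemma msize_monomial i j : msize (X ^+ i * Y ^+ j) = (i + j).+1.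
Proof.
have -> : X ^+ i * Y ^+ j = 'X_[(U_((0 : 'I_2)%R) *+ i + U_((1 : 'I_2)%R) *+ j)%MM].
  by rewrite mpolyXD !mpolyXn.
by rewrite msizeX mdegD !mdegMn !mdeg1 !mul1n.
Qed.

Lemma mpolyX2 (m : 'X_{1..2}) : 'X_[R, m] = X ^+ m 0 * Y ^+ m 1.
Proof.
rewrite mpolyXE_id !big_ord_recl big_ord0 mulr1.
by rewrite (_ : lift _ _ = 1) //; apply/val_inj.
Qed.

Lemma mdeg2 (m : 'X_{1..2}) : mdeg m = (m 0%R + m 1%R)%N.
Proof.
rewrite mdegE !big_ord_recl big_ord0 addn0.
by rewrite (_ : lift _ _ = 1) //; apply/val_inj.
Qed.

End TwoVariables.

(** * Restriction to the parametrized curve *)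

Section Pullback.
Variables (R : realType) (l1 l2 : nat).

(** The polynomial [t ^ (n l1) * f (t ^ l2, t ^ - l1)]. When [f] has degree at
    most [n] its exponents [m 0 * l2 + n * l1 - m 1 * l1] are not truncated. *)
Definition pullback n (f : {mpoly R[2]}) : {poly R} :=
  \sum_(m <- msupp f) f@_m *: 'X^(m 0%R * l2 + n * l1 - m 1%R * l1).

Lemma size_pullback n f : deg_le n f ->
  (size (pullback n f) <= (n * (l1 + l2)).+1)%N.
Proof.
move=> fn; rewrite /pullback big_seq.
apply: (big_ind (fun q : {poly R} => size q <= (n * (l1 + l2)).+1)%N).
- by rewrite size_poly0.
- move=> q r qn rn; apply: leq_trans (size_polyD _ _) _.
  by rewrite geq_max qn.
move=> m /msize_mdeg_lt/leq_trans/(_ fn); rewrite ltnS mdeg2 => mn.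
apply: leq_trans (size_scale_leq _ _) _; rewrite size_polyXn; nia.
Qed.

Lemma horner_pullback n f t : deg_le n f -> t != 0 ->
  (pullback n f).[t] =
    t ^+ (n * l1) * f.@[fun i => if i == 0 then t ^+ l2 else t^-1 ^+ l1].
Proof.
move=> fn t0; rewrite mevalE horner_sum mulr_sumr.
rewrite [LHS]big_seq [RHS]big_seq.
apply: eq_bigr => m /msize_mdeg_lt/leq_trans/(_ fn); rewrite ltnS mdeg2 => mn.
rewrite hornerZ hornerXn !big_ord_recl big_ord0 mulr1 /= mulrCA; congr (_ * _).
rewrite (_ : lift _ _ = 1); last exact/val_inj.
rewrite -!exprM exprVn exprB ?unitfE //; last by nia.
rewrite exprD [(m 0%R * l2)%N]mulnC [(m 1%R * l1)%N]mulnC; ring.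
Qed.

(** At [t = 0], which is no point of the curve, nonnegativity follows by
    continuity. *)
Lemma pullback_ge0 n f : deg_le (2 * n) f ->
    (forall v, zero_locus (monomial_curve R l1 l2) v -> 0 < f.@[v]) ->
  forall t, 0 <= (pullback (2 * n) f).[t].
Proof.
move=> fn f_gt0.
have off t : t != 0 -> 0 <= (pullback (2 * n) f).[t].
  (* The factor [t ^ (2 n l1)] is a square. *)
  move=> t0; rewrite horner_pullback // -mulnA mulnC exprM.
  rewrite mulr_ge0 ?sqr_ge0 // ltW // f_gt0 // /zero_locus.
  rewrite mevalB mevalM !rmorphXn /= !mevalXU meval1 /=.
  by rewrite -!exprM [(l1 * l2)%N]mulnC -exprMn divff // expr1n subrr.
by move=> t; have [->|/off//] := eqVneq t 0; apply: poly_ge0_limit.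
Qed.

End Pullback.

(** * The coordinate ring of the curve *)

(** Here [r] stands for the exponent of a nonnegative power of [t]. By Bezout
    some [j < l2] makes [r + j * l1] divisible by [l2], and then
    [i * l2 < (s + l1) * l2]. *)
Lemma low_degree_exponents l1 l2 s r :
    (0 < l1)%N -> (0 < l2)%N -> coprime l1 l2 -> (r <= s * l2)%N ->
  exists i j, (i * l2 = r + j * l1)%N /\ (i + j <= s + l1 + l2 - 2)%N.
Proof.
move=> l1_gt0 l2_gt0 co rs.
have [b _ /dvdnP[a ab]] := Bezoutr l1 l2_gt0; rewrite gcdnC in ab.
have {}ab : (1 + b * l1 = a * l2)%N by rewrite -ab -(eqP co) gcdnC.
set j := ((r * b) %% l2)%N; have jl2 : (j < l2)%N by rewrite ltn_mod.
have /dvdnP[i ij] : (l2 %| r + j * l1)%N.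
  rewrite /dvdn -modnDmr modnMml modnDmr.
  by rewrite (_ : r + r * b * l1 = r * a * l2)%N ?modnMl //; nia.
exists i, j; split=> //.
have : (i < s + l1)%N by rewrite -(ltn_pmul2r l2_gt0); nia.
lia.
Qed.

Section Curve.
Variables (R : realType) (l1 l2 : nat).
Hypotheses (l1_gt0 : (0 < l1)%N) (l2_gt0 : (0 < l2)%N) (co : coprime l1 l2).
Local Notation X := (X R).
Local Notation Y := (Y R).
Local Notation p := (monomial_curve R l1 l2).
Local Notation "x ≡ y" := (congr_mod p x y) (at level 70).

(** Two monomials that restrict to the same power of [t] have exponents
    differing by a multiple of [(l1, l2)], by coprimality, so one is the
    other times a power of [X ^+ l1 * Y ^+ l2], which is congruent to 1. *)
Lemma monomial_congr i j i' j' :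
  (i * l2 + j' * l1 = i' * l2 + j * l1)%N ->
  X ^+ i * Y ^+ j ≡ X ^+ i' * Y ^+ j'.
Proof.
wlog ii' : i j i' j' / (i' <= i)%N => [hw e|e].
  have [/hw|/ltnW/hw] := leqP i' i; first exact.
  by move=> H; apply/congr_mod_sym/H.
have jj' : (j' <= j)%N by nia.
have /dvdnP[s si] : (l1 %| i - i')%N.
  rewrite -(Gauss_dvdl _ co); apply/dvdnP; exists (j - j')%N; nia.
have -> : i = (i' + l1 * s)%N by lia.
have -> : j = (j' + l2 * s)%N by nia.
rewrite !exprD !exprM mulrACA -[X in _ ≡ X]mulr1.
apply: congr_modM; first exact: congr_mod_refl.
rewrite -exprMn -(expr1n _ s); apply: congr_modX.
by exists 1; rewrite mulr1.
Qed.

(** [U] and [V] represent [t] and [t ^ -1]: the monomial [x ^ i y ^ j] restricts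
    to [t ^ (i l2 - j l1)], and the equation between exponents reads
    [i l2 - j l1 = k - s l1] without subtraction. *)
Definition curve_parameter (U V : {mpoly R[2]}) := forall i j s k,
  (i * l2 + s * l1 = k + j * l1)%N -> X ^+ i * Y ^+ j ≡ V ^+ (s * l1) * U ^+ k.

(** The exponents of [U] and [V] are Bezout coefficients of [l1] and [l2]. *)
Lemma exists_curve_parameter : exists U V, curve_parameter U V.
Proof.
have [b _ /dvdnP[a ab]] := Bezoutr l1 l2_gt0; rewrite gcdnC in ab.
have [c _ /dvdnP[d cd]] := Bezoutl l2 l1_gt0.
rewrite (eqP co) in cd; rewrite gcdnC (eqP co) in ab.
exists (X ^+ a * Y ^+ b), (X ^+ c * Y ^+ d) => i j s k e.
rewrite !exprMn -!exprM mulrACA -!exprD.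
apply: monomial_congr; nia.
Qed.

Variables (U V : {mpoly R[2]}).
Hypothesis UVP : curve_parameter U V.

Lemma pullback_congr n f : deg_le n f ->
  f ≡ V ^+ (n * l1) * horner_alg U (pullback l1 l2 n f).
Proof.
move=> fn; rewrite {1}(mpolyE f) rmorph_sum mulr_sumr.
apply: congr_mod_sum => m /msize_mdeg_lt/leq_trans/(_ fn); rewrite ltnS mdeg2 => mn.
rewrite -mul_polyC rmorphM rmorphXn /= horner_algC horner_algX mulr_algl.
rewrite -scalerAr mpolyX2.
rewrite -!mul_mpolyC; apply: congr_modM; first exact: congr_mod_refl.
by apply: UVP; nia.
Qed.

(** By linearity it is enough to lift each power of [t]; the case distinction is
    on the sign of its exponent [k - n * l1], the negative case being the
    positive one with the two variables exchanged. *)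
Lemma low_degree_lift n (A : {poly R}) : (size A <= (n * (l1 + l2)).+1)%N ->
  exists2 g, deg_le (n + l1 + l2 - 1) g &
    g ≡ V ^+ (n * l1) * horner_alg U A.
Proof.
move=> sA; rewrite -[A]coefK poly_def rmorph_sum mulr_sumr.
apply: (big_ind (fun q => exists2 g, deg_le (n + l1 + l2 - 1) g & g ≡ q)).
- by exists 0; [rewrite /deg_le msize0 | exact: congr_mod_refl].
- move=> q q' [g dg gq] [g' dg' gq']; exists (g + g'); last exact: congr_modD.
  by rewrite /deg_le (leq_trans (msizeD_le _ _)) // geq_max; apply/andP.
move=> k _; have kn : (k <= n * (l1 + l2))%N.
  by rewrite -ltnS (leq_trans (ltn_ord k)).
have [i [j [ij dij]]] : exists i j, (i * l2 + n * l1 = k + j * l1)%N /\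
                             (i + j <= n + l1 + l2 - 2)%N.
  have [nk|/ltnW kn'] := leqP (n * l1) k.
    have [|i [j [ij d]]] := low_degree_exponents (s := n) (r := (k - n * l1)%N) l1_gt0 l2_gt0 co.
      by nia.
    by exists i, j; split=> //; lia.
  have co' : coprime l2 l1 by rewrite coprime_sym.
  have [|j [i [ij d]]] := low_degree_exponents (s := n) (r := (n * l1 - k)%N) l2_gt0 l1_gt0 co'.
    by nia.
  by exists i, j; split=> //; lia.
exists (A`_k *: (X ^+ i * Y ^+ j)).
  by rewrite /deg_le (leq_trans (msizeZ_le _ _)) // msize_monomial; lia.
rewrite -mul_polyC rmorphM rmorphXn /= horner_algC horner_algX mulr_algl.
rewrite -scalerAr -!mul_mpolyC.
by apply: congr_modM; [exact: congr_mod_refl | exact: UVP].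
Qed.

Lemma low_degree_lift_sqr n (s : seq {poly R}) :
    {in s, forall A : {poly R}, size A <= (n * (l1 + l2)).+1}%N ->
  exists2 gs : seq {mpoly R[2]}, all (deg_le (n + l1 + l2 - 1)) gs &
    \sum_(g <- gs) g ^+ 2 ≡
      V ^+ (2 * n * l1) * horner_alg U (\sum_(A <- s) A ^+ 2).
Proof.
elim: s => [_|A s IHs sA].
  by exists [::]; rewrite // !big_nil rmorph0 mulr0; apply: congr_mod_refl.
have [B sB|gs dgs gsE] := IHs; first by apply: sA; rewrite inE sB orbT.
have [g dg gE] := low_degree_lift (sA A (mem_head _ _)).
exists (g :: gs); first by rewrite /= dg.
rewrite !big_cons rmorphD rmorphXn mulrDr; apply: congr_modD gsE.
by rewrite -mulnA mulnC exprM -exprMn; apply: congr_modX.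
Qed.

End Curve.

Unset Implicit Arguments.

Theorem corollary4p2 (R : realType) (l1 l2 n : nat)
    (hl1 : (1 < l1)%N) (hl2 : (1 < l2)%N) (hgcd : gcdn l1 l2 = 1%N)
    (hn : (l1 + l2 <= n)%N)
    (f : {mpoly R[2]}) (hf : deg_le (2 * n) f)
    (hpos : forall v : 'I_2 -> R,
        zero_locus (monomial_curve R l1 l2) v -> 0 < f.@[v]) :
  exists (r : nat) (g : 'I_r -> {mpoly R[2]}) (h : {mpoly R[2]}),
    [/\ f = \sum_(j < r) g j ^+ 2 + monomial_curve R l1 l2 * h,
        forall j : 'I_r, deg_le (2 * (n + l1 + l2 - 1)) (g j ^+ 2)
      & deg_le (2 * (n + l1 + l2 - 1)) (monomial_curve R l1 l2 * h)].
Proof.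
have l1_gt0 := ltnW hl1; have l2_gt0 := ltnW hl2; have co := introT eqP hgcd.
have [U [V UVP]] := exists_curve_parameter R l1_gt0 l2_gt0 co.
have [s [PE sA]] := poly_ge0_sum_sqr (pullback_ge0 hf hpos).
have [A /sA|gs dgs gsE] := low_degree_lift_sqr (n := n) l1_gt0 l2_gt0 co UVP (s := s).
  have half u v w : (2 * u <= v.+1 -> v <= (2 * n * w).+1 -> u <= (n * w).+1)%N.
    by nia.
  by move=> /half; apply; apply: size_pullback.
have [h hE] : congr_mod (monomial_curve R l1 l2) f (\sum_(g <- gs) g ^+ 2).
  apply: congr_mod_trans (pullback_congr l1_gt0 l2_gt0 co UVP hf) _.
  by rewrite PE; apply: congr_mod_sym.
have dsqr g : g \in gs -> deg_le (2 * (n + l1 + l2 - 1)) (g ^+ 2).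
  move=> /(allP dgs); rewrite /deg_le => dg.
  have [->|g0] := eqVneq g 0; first by rewrite expr0n msize0.
  have double u d : (u <= d.+1 -> (u + u).-1 <= (2 * d).+1)%N by lia.
  by rewrite expr2 msizeM //; apply: double.
exists (size gs), (tnth (in_tuple gs)), h; split.
- by rewrite -(big_tnth _ _ gs xpredT (fun g => g ^+ 2)) -hE addrC subrK.
- by move=> j; apply/dsqr/mem_tnth.
(* The multiple of the curve is bounded as the difference [f - \sum g ^+ 2]. *)
rewrite -hE /deg_le (leq_trans (msizeD_le _ _)) // geq_max; apply/andP; split.
  by apply: leq_trans hf _; lia.
rewrite msizeN big_seq.
apply: (big_ind (deg_le (2 * (n + l1 + l2 - 1)))) dsqr => [|q r dq dr].
  by rewrite /deg_le msize0.
by rewrite /deg_le (leq_trans (msizeD_le _ _)) // geq_max; apply/andP.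
Qed.
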